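(* Assume that $\det\gamma_j\ne 0$ for all $j\geqslant 1$, and let $\theta\geqslant 0$. Then the function $\Delta_\theta$ admits the factorisation $$\Delta_\theta(\lambda)=S\,G(i\lambda)^*H_\theta\,G(i\lambda)\,S,\qquad \lambda\in\mathbb{R},$$ where $G$ is the infinite block column transfer function with blocks $G_k$, $k\geqslant0$, and $H_\theta$ is the infinite block-diagonal matrix defined in the context, so that $G(i\lambda)^*H_\theta G(i\lambda)=\sum_{k=0}^{\infty}(-2i\theta)^k\phi_k\,G_k(i\lambda)^*\beta_kG_k(i\lambda)$.
   Context: Setting: $n,m$ are even positive integers; $\Theta\in\mathbb{R}^{n\times n}$ is a nonsingular antisymmetric matrix; $R=R^{\mathrm T}\in\mathbb{R}^{n\times n}$; $M\in\mathbb{R}^{m\times n}$; $J:=\begin{bmatrix}0&I_{m/2}\\ -I_{m/2}&0\end{bmatrix}$; $A:=2\Theta(R+M^{\mathrm T}JM)$, $B:=2\Theta M^{\mathrm T}$, $\mho:=BJB^{\mathrm T}$ (so $A\Theta+\Theta A^{\mathrm T}+\mho=0$). The matrix $A$ is assumed to be Hurwitz. $(\cdot)^*$ is the complex conjugate transpose. Let $\Omega:=I_m+iJ$ (Hermitian, positive semi-definite), $\Omega^{\mathrm T}=I_m-iJ$, and let $S:=\sqrt{B\Omega^{\mathrm T}B^{\mathrm T}}$ be the positive semi-definite Hermitian square root. Let $E(s):=(sI_n-A)^{-1}$ and $\Psi(\lambda):=E(i\lambda)\mho E(i\lambda)^*$ for $\lambda\in\mathbb{R}$ (skew-Hermitian).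 Let $\phi(u):=\sum_{k\geqslant0}\phi_ku^k$ with $\phi_k:=\frac{1}{(k+1)!}$, i.e. $\phi(u)=(\mathrm{e}^u-1)/u$ for $u\neq0$, $\phi(0)=1$. Define $$\Sigma_\theta(\lambda):=E(i\lambda)^*\phi(2i\theta\Psi(\lambda))E(i\lambda),\qquad \Delta_\theta(\lambda):=S\Sigma_\theta(\lambda)S .$$ Matrices $\alpha_j,\beta_j,\gamma_j\in\mathbb{R}^{n\times n}$ are defined recursively by $\alpha_{j+1}=\gamma_j\beta_j$, $\beta_{j+1}=\gamma_j^{-1}\alpha_j\gamma_{j-1}\gamma_j^{-1}$, $\gamma_j=\mathcal{L}_A(\alpha_j\gamma_{j-1})$ for $j\geqslant1$, with $\alpha_1=\gamma_0=\Theta$, $\beta_1=\Theta^{-1}\mho\Theta^{-1}$, $\beta_0:=I_n$, where $\mathcal{L}_A(V):=\int_0^\infty\mathrm{e}^{tA}V\mathrm{e}^{tA^{\mathrm T}}\mathrm{d}t$. Define $G_0:=E$ and $G_k(s):=E(s)\alpha_kE(s)\alpha_{k-1}\cdots E(s)\alpha_1E(s)$ for $k\geqslant1$; $G:=\begin{bmatrix} G_0 \\ G_1 \\ G_2 \\ \vdots \end{bmatrix}$; and $H_\theta:=\mathrm{diag}_{k\geqslant0}\big((-2i\theta)^k\phi_k\beta_k\big)$ (infinite block-diagonal). *)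

(* Defs.v *)
(* Complex matrices have entries in R[i] for R : realType. *)
From HB Require Import structures.
From mathcomp Require Import all_boot all_order all_algebra.
From mathcomp Require Import all_classical all_reals all_analysis.
From mathcomp Require Import complex.

Set Implicit Arguments.
Unset Strict Implicit.
Unset Printing Implicit Defensive.

Import Order.TTheory GRing.Theory Num.Theory.
Import numFieldNormedType.Exports.

Local Open Scope classical_set_scope.
Local Open Scope ring_scope.
Local Open Scope sesquilinear_scope.
Local Open Scope complex_scope.

(* Limits of matrices are taken in the topology of entrywise convergence. *)
Definition mx_series (K : numFieldType) (n : nat) (u : nat -> 'M[K]_n) :
    'M[K]_n :=
  limn (series u).

Definition mx_has_sum (K : numFieldType) (n : nat) (u : nat -> 'M[K]_n)
    (X : 'M[K]_n) : Prop :=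
  series u @ \oo --> X.

Definition expmx (K : numFieldType) (n : nat) (X : 'M[K]_n) : 'M[K]_n :=
  mx_series (fun k => (k`!%:R)^-1 *: X ^+ k).

Definition phi_coef (K : numFieldType) (k : nat) : K := ((k.+1)`!%:R)^-1.

(* phi(u) = (e^u - 1) / u, extended by phi(0) = 1, at a matrix argument *)
Definition phi_mx (K : numFieldType) (n : nat) (X : 'M[K]_n) : 'M[K]_n :=
  mx_series (fun k => phi_coef K k *: X ^+ k).

(* J = [0, I; -I, 0] with blocks of order m/2 *)
Definition Jmx (K : pzRingType) (m : nat) : 'M[K]_m :=
  \matrix_(i, j) (((j == i + m./2 :> nat)%N)%:R - ((i == j + m./2 :> nat)%N)%:R).

Lemma Jmx_block (K : pzRingType) (q : nat) :
  Jmx K (q + q) = block_mx 0 1%:M (- 1%:M) 0.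
Proof.
have halfq : (q + q)./2 = q by rewrite addnn doubleK.
apply/matrixP => i j; rewrite -(splitK i) -(splitK j) mxE halfq.
have neq_lt (k l : 'I_q) : ((k : nat) == (l + q)%N) = false.
  by apply/negbTE; rewrite neq_ltn ltn_addl.
have neq_lt2 (k l : 'I_q) : ((q + k)%N == (q + l + q)%N) = false.
  by apply/negbTE; rewrite -addnA eqn_add2l neq_ltn ltn_addl.
case: (fintype.split i) => k; case: (fintype.split j) => l /=.
- by rewrite block_mxEul mxE !neq_lt subrr.
- rewrite block_mxEur mxE [(q + l)%N]addnC eqn_add2r -addnA.
  have -> : ((k : nat) == (l + (q + q))%N) = false.
    by apply/negbTE; rewrite neq_ltn addnA ltn_addl.
  by rewrite subr0 eq_sym.
- rewrite block_mxEdl !mxE [(q + k)%N]addnC eqn_add2r -addnA.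
  have -> : ((l : nat) == (k + (q + q))%N) = false.
    by apply/negbTE; rewrite neq_ltn addnA ltn_addl.
  by rewrite sub0r.
- by rewrite block_mxEdr mxE !neq_lt2 subrr.
Qed.

Section Real.
Variables (R : realType) (n : nat).

Definition mxC (p q : nat) (X : 'M[R]_(p, q)) : 'M[R[i]]_(p, q) :=
  map_mx (real_complex R) X.

Definition hurwitz (A : 'M[R]_n) : Prop :=
  forall z : R[i], eigenvalue (mxC A) z -> 'Re z < 0.

(* L_A(V) = int_0^oo e^(tA) V e^(tA^T) dt, entrywise *)
Definition lyap (A V : 'M[R]_n) : 'M[R]_n :=
  \matrix_(i, j) \int[lebesgue_measure]_(t in `[0, +oo[%classic)
    ((expmx (t *: A) *m V *m expmx (t *: A^T)) i j).

Section Recursion.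
Variables (A Theta mho : 'M[R]_n).

(* the triple (alpha_(j+1), beta_(j+1), gamma_j) *)
Fixpoint abg (j : nat) : 'M[R]_n * 'M[R]_n * 'M[R]_n :=
  if j is j'.+1 then
    let: (a, b, g) := abg j' in
    let g' := lyap A (a *m g) in
    (g' *m b, invmx g' *m a *m g *m invmx g', g')
  else (Theta, invmx Theta *m mho *m invmx Theta, Theta).

(* alpha_j is meaningful for j >= 1 only; alpha 0 is a dummy value. *)
Definition alpha (j : nat) : 'M[R]_n := (abg j.-1).1.1.
Definition beta (j : nat) : 'M[R]_n :=
  if j is j'.+1 then (abg j').1.2 else 1%:M.
Definition gamma (j : nat) : 'M[R]_n := (abg j).2.

Lemma abg_init :
  [/\ alpha 1 = Theta, gamma 0 = Theta, beta 0 = 1%:M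
    & beta 1 = invmx Theta *m mho *m invmx Theta].
Proof. by []. Qed.

Lemma abg_rec (j : nat) : (0 < j)%N ->
  [/\ alpha j.+1 = gamma j *m beta j,
      beta j.+1 =
        invmx (gamma j) *m alpha j *m gamma j.-1 *m invmx (gamma j)
    & gamma j = lyap A (alpha j *m gamma j.-1)].
Proof.
by case: j => // j _; rewrite /alpha /beta /gamma /=; case: (abg j) => [[]].
Qed.

End Recursion.
End Real.

Section Complex.
Variables (R : realType) (n : nat).
Local Notation C := R[i].

(* On R[i], 0 <= z means that z is real and nonnegative. *)
Definition psd_hermitian (S : 'M[C]_n) : Prop :=
  S \is hermsymmx /\ forall v : 'cV[C]_n, 0 <= (v^t* *m S *m v) 0 0.

Definition is_psd_sqrt (P S : 'M[C]_n) : Prop :=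
  psd_hermitian S /\ S *m S = P.

Definition Omega (m : nat) : 'M[C]_m := 1%:M + 'i *: Jmx C m.

(* E(s) = (s I - A)^-1 *)
Definition resolvent (A : 'M[R]_n) (s : C) : 'M[C]_n :=
  invmx (s%:M - mxC A).

Definition Psi (A mho : 'M[R]_n) (lambda : R) : 'M[C]_n :=
  let E := resolvent A ('i * lambda%:C) in E *m mxC mho *m E^t*.

Definition Sigma (A mho : 'M[R]_n) (theta lambda : R) : 'M[C]_n :=
  let E := resolvent A ('i * lambda%:C) in
  E^t* *m phi_mx ((2 * 'i * theta%:C) *: Psi A mho lambda) *m E.

Definition Delta (A mho : 'M[R]_n) (S : 'M[C]_n) (theta lambda : R) :
    'M[C]_n :=
  S *m Sigma A mho theta lambda *m S.

(* Infinite block columns and rows are sequences of blocks; infinite block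
   matrices are doubly indexed families. The products are block series. *)
Definition blkdiag (D : nat -> 'M[C]_n) (j k : nat) : 'M[C]_n :=
  if j == k then D k else 0.
Definition blkcol_adj (G : nat -> 'M[C]_n) (k : nat) : 'M[C]_n := (G k)^t*.
Definition blkmx_mul_col (H : nat -> nat -> 'M[C]_n) (G : nat -> 'M[C]_n)
    (j : nat) : 'M[C]_n :=
  mx_series (fun k => H j k *m G k).
Definition blkrow_mul_col (F G : nat -> 'M[C]_n) : 'M[C]_n :=
  mx_series (fun k => F k *m G k).

Section Factors.
Variables (A Theta mho : 'M[R]_n).

(* G_k = E alpha_k E alpha_(k-1) ... E alpha_1 E *)
Fixpoint Gblk (s : C) (k : nat) : 'M[C]_n :=
  if k is k'.+1 then
    resolvent A s *m mxC (alpha A Theta mho k) *m Gblk s k'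
  else resolvent A s.

Definition Hcoef (theta : R) (k : nat) : C :=
  (- (2 * 'i * theta%:C)) ^+ k * phi_coef C k.

Definition Hblk (theta : R) : nat -> nat -> 'M[C]_n :=
  blkdiag (fun k => Hcoef theta k *: mxC (beta A Theta mho k)).

(* G(i lambda)^* H_theta G(i lambda) *)
Definition GHG (theta lambda : R) : 'M[C]_n :=
  let G := Gblk ('i * lambda%:C) in
  blkrow_mul_col (blkcol_adj G) (blkmx_mul_col (Hblk theta) G).

End Factors.
End Complex.

(* Main.v *)
(* By the Lyapunov equation A Theta + Theta A^T + mho = 0, the product
   E mho E^* equals Theta E^* beta_1 E Theta at s = i lambda. More generally,
   if A g + g A^T + W = 0 with g invertible then
   E W E^* = E g + g E^* = g E^* (g^-1 W g^-1) E g.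
   With W_0 = mho and W_(j+1) = gamma_j beta_j gamma_j, the matrix gamma_j solves
   this equation for W = W_j and beta_(j+1) = gamma_j^-1 W_j gamma_j^-1. Applying
   the identity to every factor of E^* (beta_j E W_j E^* )^(k+1) beta_j E turns it
   into E^* beta_j gamma_j [E^* (beta_(j+1) E W_(j+1) E^* )^k beta_(j+1) E] gamma_j beta_j E.
   Unrolling from j = 0 and using (gamma_j beta_j)^T = - beta_j gamma_j gives
   E^* Psi^k E = (-1)^k G_k^* beta_k G_k, and the theorem follows termwise.
   That gamma_j solves its Lyapunov equation for j >= 1 requires the
   exponential decay of e^(tA), obtained from the Cayley-Hamilton theorem by
   integrating one linear factor of the characteristic polynomial at a time. *)
Require Import Defs.
From HB Require Import structures.
From mathcomp Require Import all_boot all_order all_algebra.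
From mathcomp Require Import all_classical all_reals all_analysis.
From mathcomp Require Import measurable_realfun complex ring lra.

Import Order.TTheory GRing.Theory Num.Theory.
Import numFieldNormedType.Exports.

Set Implicit Arguments.
Unset Strict Implicit.
Unset Printing Implicit Defensive.

Local Open Scope classical_set_scope.
Local Open Scope ring_scope.
Local Open Scope sesquilinear_scope.
Local Open Scope complex_scope.

(** * Entrywise convergence of matrix series *)

Lemma cvg_mxP (K : numFieldType) (p q : nat) (u : nat -> 'M[K]_(p, q))
    (X : 'M[K]_(p, q)) :
  u @ \oo --> X <-> forall i j, (fun k => u k i j) @ \oo --> X i j.
Proof.
split=> [uX i j|uX].
  exact: (cvg_comp _ (fun M : 'M[K]_(p, q) => M i j) uX (coord_continuous (x:=X))).
apply/cvg_ballP => e e0.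
(* There are finitely many index pairs, so the entrywise neighbourhoods of infinity have a common
   one. *)
have : \forall k \near \oo, forall ij : 'I_p * 'I_q, ball (X ij.1 ij.2) e (u k ij.1 ij.2).
  apply: filter_forall => -[i j] /=.
  by move: (uX i j) => /cvg_ballP; apply.
by apply: filterS => k H; split=> // i j; exact: (H (i, j)).
Qed.

Lemma cvg_mulmx (K : numFieldType) (p q r s : nat) (P : 'M[K]_(p, q))
    (u : nat -> 'M[K]_(q, r)) (X : 'M[K]_(q, r)) (Q : 'M[K]_(r, s)) :
  u @ \oo --> X -> (fun k => P *m u k *m Q) @ \oo --> P *m X *m Q.
Proof.
move=> /cvg_mxP uX; apply/cvg_mxP => i j; rewrite mxE.
have -> : (fun k => (P *m u k *m Q) i j) =
    (fun k => \sum_l (\sum_h P i h * u k h l) * Q l j).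
  by apply/funext => k; rewrite mxE; apply: eq_bigr => l _; rewrite mxE.
apply: (cvg_big add_continuous) => l _; rewrite mxE; apply: cvgMr_tmp.
by apply: (cvg_big add_continuous) => h _; apply: cvgMl_tmp.
Qed.

Lemma mx_expr_bound (K : numDomainType) (n : nat) (X : 'M[K]_n) (b : K) :
  0 <= b -> (forall i j, `|X i j| <= b) ->
  forall k i j, `|(X ^+ k) i j| <= (n%:R * b) ^+ k.
Proof.
move=> b0 Xb; elim=> [|k IH] i j.
  by rewrite !expr0 mxE; case: (_ == _); rewrite ?normr1 ?normr0.
rewrite exprS mxE exprS; apply: le_trans (ler_norm_sum _ _ _) _.
apply: (le_trans (y := \sum_(l < n) b * (n%:R * b) ^+ k)).
  by apply: ler_sum => l _; rewrite normrM ler_pM.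
by rewrite sumr_const card_ord -mulrA [leRHS]mulr_natl.
Qed.

Lemma mx_entry_bound (K : numDomainType) (p q : nat) (X : 'M[K]_(p, q)) :
  exists2 b, 0 <= b & forall i j, `|X i j| <= b.
Proof.
exists (\sum_i \sum_j `|X i j|); first by do 2!apply: sumr_ge0 => ? _.
move=> i j; rewrite (bigD1 i) //= (bigD1 j) //= -addrA lerDl.
by rewrite addr_ge0 // ?sumr_ge0 // => k _; rewrite sumr_ge0.
Qed.

Lemma series_mxE (K : numFieldType) (p q : nat) (u : nat -> 'M[K]_(p, q)) k i j :
  series u k i j = series (fun l => u l i j) k.
Proof. by rewrite /series /= summxE. Qed.

Lemma limnE (K : numFieldType) (V : normedModType K) (u : nat -> V) (X : V) :
  u @ \oo --> X -> limn u = X.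
Proof. exact/cvg_lim/norm_hausdorff. Qed.

Lemma mx_has_sum_lim (K : numFieldType) (n : nat) (u : nat -> 'M[K]_n) X :
  mx_has_sum u X -> mx_series u = X.
Proof. exact: limnE. Qed.

(** The real comparison test applies to the real and imaginary parts separately, since both are at
    most [|u k|] in absolute value; the two limits are then recombined. *)
Lemma series_complex_cvg (R : realType) (u : nat -> (R[i] : numFieldType)) (v : nat -> R) :
  (forall k, `|u k| <= (v k)%:C) -> cvgn (series v) ->
  exists l : (R[i] : numFieldType), series u @ \oo --> l.
Proof.
move=> uv vcvg.
have v0 k : 0 <= v k by rewrite -lecR; exact: le_trans (normr_ge0 (u k)) (uv k).
have dominated (w : nat -> R) : (forall k, `|w k|%:C <= `|u k|) -> cvgn (series w).
  move=> wu; apply: normed_cvg; apply: (series_le_cvg _ v0 _ vcvg) => k.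
    exact: normr_ge0.
  by rewrite -lecR; exact: le_trans (wu k) (uv k).
have reC := dominated (fun k => complex.Re (u k)) (fun k => normc_ge_Re (u k)).
have imC : cvgn (series (fun k => complex.Im (u k))).
  (* Up to sign, Im z is the real part of z times i, which has the same modulus as z. *)
  apply: dominated => k; rewrite -normrN -ReiNIm (le_trans (normc_ge_Re _)) //.
  by rewrite normrM normCi mulr1.
have toC (w : nat -> R) (l : R) : w @ \oo --> l ->
    (fun k => (w k)%:C : (R[i] : numFieldType)) @ \oo --> (l%:C : (R[i] : numFieldType)).
  (* A positive radius in [R[i]] has zero imaginary part, so it is a real radius. *)
  move=> wl; apply/cvg_ballP => e; case: e => e e'; rewrite ltcE /= => /andP[/eqP -> e0].
  move/cvg_ballP : wl => /(_ e e0); apply: filterS => k.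
  by rewrite /ball /= -rmorphB normc_def /= expr0n addr0 sqrtr_sqr ltcR.
exists ((limn (series (fun k => complex.Re (u k))))%:C +
        'i%C * (limn (series (fun k => complex.Im (u k))))%:C).
have -> : series u = fun N => (series (fun k => complex.Re (u k)) N)%:C +
        'i%C * (series (fun k => complex.Im (u k)) N)%:C.
  apply/funext => N; rewrite /series /= !raddf_sum mulr_sumr -big_split /=.
  by apply: eq_bigr => k _; exact: complexE.
by apply: cvgD; [exact: toC | apply: cvgMl_tmp; exact: toC].
Qed.

Lemma phi_mx_has_sum (R : realType) (n : nat) (X : 'M[R[i]]_n) :
  mx_has_sum (fun k => phi_coef R[i] k *: X ^+ k) (phi_mx X).
Proof.
have [b b0 Xb] := mx_entry_bound X.
(* The bound [b] lies in [R[i]] but is nonnegative, hence real. The entries are then dominated by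
   the terms of the real series of e^c, because 1/(k+1)! <= 1/k!. *)
pose c : R := n%:R * complex.Re b.
have cE : n%:R * b = c%:C.
  by rewrite rmorphM /= rmorph_nat RRe_real // ger0_real.
have entry i j : exists l : (R[i] : numFieldType),
      series (fun k => (phi_coef R[i] k *: X ^+ k) i j : (R[i] : numFieldType)) @ \oo --> l.
  apply: (@series_complex_cvg _ _ (exp_coeff c)); last exact: is_cvg_series_exp_coeff.
  move=> k; rewrite mxE normrM /exp_coeff /= mulrC rmorphM /= rmorphXn /= -cE.
  rewrite ler_pM ?mx_expr_bound // /phi_coef ger0_norm ?invr_ge0 //.
  rewrite fmorphV rmorph_nat lef_pV2 ?posrE ?ltr0n ?fact_gt0 //.
  by rewrite ler_nat leq_fact.
have /cid[Y XY] : exists Y, mx_has_sum (fun k => phi_coef R[i] k *: X ^+ k) Y.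
  exists (\matrix_(i, j) sval (cid (entry i j))); apply/cvg_mxP => i j; rewrite mxE.
  under eq_fun do rewrite series_mxE.
  exact: svalP (cid (entry i j)).
by rewrite /phi_mx (mx_has_sum_lim XY).
Qed.

(** * The matrix exponential *)

(** Turns each entry of e^(tA) into a scalar power series in t, which can be differentiated
    termwise. *)
Definition expmx_coef (R : realType) (n : nat) (A : 'M[R]_n) (i j : 'I_n) (k : nat) : R :=
  (k`!%:R)^-1 * (A ^+ k) i j.

Lemma cvg_expmx_coef (R : realType) (n : nat) (A : 'M[R]_n) i j (t : R) :
  cvgn (pseries (expmx_coef A i j) t).
Proof.
have [b b0 Ab] := mx_entry_bound A.
apply: normed_cvg; apply: (series_le_cvg _ _ _ (is_cvg_series_exp_coeff (n%:R * b * `|t|))) => k /=.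
- exact: normr_ge0.
- by rewrite /exp_coeff /= divr_ge0 // exprn_ge0 // !mulr_ge0.
rewrite /exp_coeff /= !normrM normrX ger0_norm ?invr_ge0 // [leRHS]mulrC -mulrA.
by rewrite ler_wpM2l ?invr_ge0 // [leRHS]exprMn ler_wpM2r ?exprn_ge0 // mx_expr_bound.
Qed.

Lemma expr_scalemx (K : comPzRingType) (n : nat) (t : K) (A : 'M[K]_n) k :
  (t *: A) ^+ k = t ^+ k *: A ^+ k.
Proof.
elim: k => [|k IH]; first by rewrite !expr0 scale1r.
by rewrite !exprS IH -mulmxE -scalemxAl -scalemxAr scalerA.
Qed.

Lemma expmx_scale_has_sum (R : realType) (n : nat) (A : 'M[R]_n) (t : R) :
  mx_has_sum (fun k => (k`!%:R)^-1 *: (t *: A) ^+ k)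
    (\matrix_(i, j) limn (pseries (expmx_coef A i j) t)).
Proof.
apply/cvg_mxP => i j; rewrite mxE.
under eq_fun do rewrite series_mxE.
have -> : (fun l => (l`!%:R^-1 *: (t *: A) ^+ l) i j) =
    (fun l => expmx_coef A i j l * t ^+ l).
  by apply/funext => l; rewrite expr_scalemx !mxE /expmx_coef mulrA mulrAC.
exact: cvg_expmx_coef.
Qed.

Lemma expmxE (R : realType) (n : nat) (A : 'M[R]_n) (t : R) i j :
  expmx (t *: A) i j = limn (pseries (expmx_coef A i j) t).
Proof. by rewrite /expmx (mx_has_sum_lim (@expmx_scale_has_sum _ _ A t)) mxE. Qed.

Lemma expmx0 (R : realType) (n : nat) : expmx (0 : 'M[R]_n) = 1%:M.
Proof.
apply: limnE; apply: cvg_near_cst; exists 1%N => // -[//|N] _ /=.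
rewrite /series /= big_nat_recl //= expr0 fact0 invr1 scale1r big1 ?addr0 // => k _.
by rewrite expr0n /= scaler0.
Qed.

Lemma expmx_trmx (R : realType) (n : nat) (A : 'M[R]_n) (t : R) :
  expmx (t *: A^T) = (expmx (t *: A))^T.
Proof.
have trX k : (A^T) ^+ k = (A ^+ k)^T.
  elim: k => [|k IH]; first by rewrite !expr0 trmx1.
  by rewrite exprSr IH -mulmxE -trmx_mul mulmxE -exprS.
apply/matrixP => i j; rewrite mxE !expmxE; congr (limn (pseries _ t)).
by apply/funext => k; rewrite /expmx_coef trX mxE.
Qed.

(** The derived coefficients (k+1) A^(k+1) / (k+1)! = (A^k / k!) A are fixed linear combinations of
    the original ones, so the first and second derived series converge everywhere. *)
Lemma is_derive_expmx (R : realType) (n : nat) (A : 'M[R]_n) i j (t : R) :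
  is_derive t 1 (fun t => expmx (t *: A) i j) ((expmx (t *: A) *m A) i j).
Proof.
have diffsE i0 j0 : pseries_diffs (expmx_coef A i0 j0) =
    fun k => \sum_l expmx_coef A i0 l k * A l j0.
  apply/funext => k; rewrite /pseries_diffs /expmx_coef factS natrM invfM !mulrA.
  rewrite mulfV ?pnatr_eq0 // mul1r exprSr mxE mulr_sumr.
  by apply: eq_bigr => l _; rewrite mulrA.
have cvg_comb (c : 'I_n -> nat -> R) (L a : 'I_n -> R) s :
    (forall l, pseries (c l) s @ \oo --> L l) ->
    pseries (fun k => \sum_l c l k * a l) s @ \oo --> \sum_l L l * a l.
  move=> cL.
  have -> : pseries (fun k => \sum_l c l k * a l) s =
      fun N => \sum_l pseries (c l) s N * a l.
    apply/funext => N; rewrite /pseries /series /=.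
    under [RHS]eq_bigr do rewrite mulr_suml.
    rewrite exchange_big /=; apply: eq_bigr => k _.
    by rewrite mulr_suml; apply: eq_bigr => l _; rewrite mulrAC.
  by apply: (cvg_big add_continuous) => l _; exact: cvgMr_tmp.
have cvg_diffs i0 j0 s : pseries (pseries_diffs (expmx_coef A i0 j0)) s @ \oo -->
    (expmx (s *: A) *m A) i0 j0.
  rewrite mxE diffsE; apply: cvg_comb => l.
  by rewrite expmxE; exact: cvg_expmx_coef.
rewrite -(limnE (cvg_diffs i j t)).
have -> : (fun t => expmx (t *: A) i j) = fun t => limn (pseries (expmx_coef A i j) t).
  by apply/funext => s; rewrite expmxE.
(* Any point of modulus larger than [|t|] serves here. *)
apply: (@pseries_snd_diffs _ _ (`|t| + 1)).
- exact: cvg_expmx_coef.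
- exact: cvgP (@cvg_diffs _ _ _).
- rewrite diffsE.
  have -> : pseries_diffs (fun k => \sum_l expmx_coef A i l k * A l j) =
      fun k => \sum_l pseries_diffs (expmx_coef A i l) k * A l j.
    apply/funext => k; rewrite /pseries_diffs mulr_sumr.
    by apply: eq_bigr => l _; rewrite mulrA.
  by apply/cvgP/cvg_comb => l; exact: cvg_diffs.
- by rewrite [ltRHS]ger0_norm ?ltrDl // addr_ge0.
Qed.

Lemma is_derive_expmx_sandwich (R : realType) (n : nat) (A V : 'M[R]_n) i j (t : R) :
  is_derive t 1 (fun t => (expmx (t *: A) *m V *m expmx (t *: A^T)) i j)
    ((expmx (t *: A) *m (A *m V + V *m A^T) *m expmx (t *: A^T)) i j).
Proof.
(* With e^(tA^T) written as the transpose of e^(tA), the product rule involves only entries of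
   e^(tA). *)
have entryE (e f : 'M[R]_n) : (e *m V *m f^T) i j = \sum_l \sum_h e i h * V h l * f j l.
  rewrite mxE; apply: eq_bigr => l _; rewrite !mxE mulr_suml.
  by apply: eq_bigr.
have -> : (fun t => (expmx (t *: A) *m V *m expmx (t *: A^T)) i j) =
    \sum_l \sum_h (fun t => expmx (t *: A) i h * V h l * expmx (t *: A) j l).
  apply/funext => s; rewrite expmx_trmx entryE fct_sumE; apply: eq_bigr => l _.
  by rewrite fct_sumE.
have -> : (expmx (t *: A) *m (A *m V + V *m A^T) *m expmx (t *: A^T)) i j =
   \sum_l \sum_h ((expmx (t *: A) *m A) i h * V h l * expmx (t *: A) j l
     + expmx (t *: A) i h * V h l * (expmx (t *: A) *m A) j l).
  rewrite expmx_trmx mulmxDr mulmxDl !mulmxA mxE.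
  have -> : (expmx (t *: A) *m V *m A^T *m (expmx (t *: A))^T) =
     expmx (t *: A) *m V *m (expmx (t *: A) *m A)^T by rewrite trmx_mul mulmxA.
  by rewrite !entryE -big_split /=; apply: eq_bigr => l _; rewrite -big_split.
apply: is_derive_sum => l; apply: is_derive_sum => h.
have di := is_derive_expmx A i h t; have dj := is_derive_expmx A j l t.
by apply: is_derive_eq; rewrite scaler0 add0r /GRing.scale /=; ring.
Qed.

(** * Exponential decay *)

(** Rate and constant are existential, so sums and products preserve decay without tracking
    either. *)
Definition expdecay (R : realType) (f : R -> R) : Prop :=
  exists c K : R, [/\ 0 < c, 0 <= K & forall t, 0 <= t -> `|f t| <= K * expR (- (c * t))].

Lemma expdecay_le (R : realType) (f g : R -> R) :
  (forall t, `|f t| <= `|g t|) -> expdecay g -> expdecay f.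
Proof.
move=> fg [c [K [c0 K0 H]]]; exists c, K; split=> // t t0.
by rewrite (le_trans (fg t)) ?H.
Qed.

Lemma expdecay0 (R : realType) : expdecay (fun _ : R => 0 : R).
Proof.
by exists 1, 0; split=> // t _; rewrite normr0 mul0r.
Qed.

Lemma expdecayD (R : realType) (f g : R -> R) :
  expdecay f -> expdecay g -> expdecay (fun t => f t + g t).
Proof.
move=> [c [K [c0 K0 fK]]] [d [L [d0 L0 gL]]].
exists (Num.min c d), (K + L); split; rewrite ?lt_min ?c0 ?addr_ge0 // => t t0.
rewrite mulrDl (le_trans (ler_normD _ _)) // lerD //.
  rewrite (le_trans (fK _ t0)) // ler_wpM2l // ler_expR lerN2 ler_wpM2r //.
  by rewrite ge_min lexx.
rewrite (le_trans (gL _ t0)) // ler_wpM2l // ler_expR lerN2 ler_wpM2r //.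
by rewrite ge_min lexx orbT.
Qed.

Lemma expdecayM (R : realType) (f g : R -> R) :
  expdecay f -> expdecay g -> expdecay (fun t => f t * g t).
Proof.
move=> [c [K [c0 K0 fK]]] [d [L [d0 L0 gL]]].
exists (c + d), (K * L); split; rewrite ?addr_gt0 ?mulr_ge0 // => t t0.
rewrite normrM mulrDl opprD expRD mulrACA.
by rewrite ler_pM ?fK ?gL.
Qed.

Lemma expdecayZ (R : realType) (f : R -> R) (a : R) :
  expdecay f -> expdecay (fun t => f t * a).
Proof.
move=> [c [K [c0 K0 fK]]]; exists c, (K * `|a|); split; rewrite ?mulr_ge0 // => t t0.
by rewrite normrM mulrAC ler_wpM2r // fK.
Qed.

Lemma expdecay_sum (R : realType) (I : finType) (f : I -> R -> R) :
  (forall i, expdecay (f i)) -> expdecay (fun t => \sum_i f i t).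
Proof.
move=> fd; rewrite -[X in expdecay X]/(fun t => _); elim: (index_enum I) => [|i s IH].
  by under eq_fun do rewrite big_nil; exact: expdecay0.
by under eq_fun do rewrite big_cons; exact: expdecayD.
Qed.

Lemma expdecay_sqr (R : realType) (f : R -> R) :
  expdecay (fun t => f t ^+ 2) -> expdecay f.
Proof.
(* [K + 1] stands in for the square root of [K]: only K <= (K + 1)^2 is needed. *)
move=> [c [K [c0 K0 fK]]]; exists (c / 2), (K + 1).
split=> [||t t0]; rewrite ?divr_gt0 ?addr_ge0 //.
rewrite -ler_sqr ?nnegrE ?mulr_ge0 ?addr_ge0 ?expR_ge0 // real_normK ?num_real //.
rewrite (le_trans (ler_norm _)) // (le_trans (fK _ t0)) // exprMn -expRM_natl.
have -> : 2%:R * - (c / 2 * t) = - (c * t) by field.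
by rewrite ler_wpM2r ?expR_ge0 //; nra.
Qed.

Lemma expdecay_cvg0 (R : realType) (f : R -> R) :
  expdecay f -> f t @[t --> +oo] --> 0.
Proof.
move=> [c [K [c0 K0 fK]]].
apply/norm_cvg0P; apply: (@squeeze_cvgr _ _ _ _ (fun=> 0) (fun t => K * expR (- (c * t)))).
- by near=> t; rewrite normr_ge0 fK.
- exact: cvg_cst.
rewrite -[X in _ --> X](mulr0 K); apply: cvgMl_tmp.
apply: (cvg_comp (fun t => c * t) (fun t => expR (- t))).
  exact: gt0_cvgMry.
exact: cvgr_expR.
Unshelve. all: by end_near. Qed.

(* For N = u^2 + v^2 and d = -a, AM-GM gives N' <= - d N + (f^2 + g^2) / d, so
   N e^(dt) - K / (d (d - c)) e^((d - c) t) is nonincreasing when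
   f^2 + g^2 <= K e^(-ct) with c < d. *)
Lemma expdecay_ode (R : realType) (a b : R) (u v f g : R -> R) :
  a < 0 ->
  (forall t : R, is_derive t 1 u (a * u t - b * v t + f t)) ->
  (forall t : R, is_derive t 1 v (b * u t + a * v t + g t)) ->
  expdecay f -> expdecay g -> expdecay u /\ expdecay v.
Proof.
move=> a0 du dv fd gd.
suff Nd : expdecay (fun t => u t ^+ 2 + v t ^+ 2).
  by split; apply: expdecay_sqr; apply: expdecay_le Nd => t;
    rewrite !ger0_norm ?addr_ge0 ?sqr_ge0 // ?lerDl ?lerDr sqr_ge0.
have [c [K [c0 K0 fgK]]] := expdecayD (expdecayM fd fd) (expdecayM gd gd).
(* The forcing rate is lowered strictly below [- a], to keep the denominator of [L] positive. *)
have [c' [c'0 c'c c'b]] : exists c', [/\ 0 < c', c' <= c & c' < - a].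
  exists (Num.min c (- a / 2)); split; rewrite ?lt_min ?gt_min ?ge_min ?lexx ?c0 //=.
    by lra.
  by apply/orP; right; lra.
pose L := K / (- a * (- a - c')).
have L0 : 0 <= L by rewrite /L divr_ge0 // mulr_ge0; lra.
pose N t := (u t ^+ 2 + v t ^+ 2) * expR (- a * t) - L * expR ((- a - c') * t).
pose N' t := (2 * u t * (a * u t - b * v t + f t) + 2 * v t * (b * u t + a * v t + g t)
    - a * (u t ^+ 2 + v t ^+ 2)) * expR (- a * t)
    - L * (- a - c') * expR ((- a - c') * t).
have dN (t : R) : is_derive t 1 N (N' t).
  have := du t; have := dv t => dut dvt.
  by apply: is_derive_eq; rewrite /GRing.scale /= /N'; ring.
have N'0 t : 0 <= t -> N' t <= 0.
  move=> t0; rewrite /N'.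
  have -> : expR ((- a - c') * t) = expR (- a * t) * expR (- (c' * t)).
    by rewrite -expRD; congr expR; ring.
  have -> : L * (- a - c') = K / - a by rewrite /L; field; lra.
  rewrite [X in _ - X]mulrCA -[X in X - _]mulrC -mulrBr pmulr_rle0 ?expR_gt0 //.
  rewrite subr_le0.
  have hfg : f t * f t + g t * g t <= K * expR (- (c' * t)).
    rewrite (le_trans (ler_norm _)) // (le_trans (fgK _ t0)) // ler_wpM2l //.
    by rewrite ler_expR lerN2 ler_wpM2r.
  rewrite -[leRHS]mulrA [_^-1 * _]mulrC [leRHS]mulrA ler_pdivlMr; last by lra.
  apply: le_trans hfg; rewrite -subr_ge0.
  (* The rotation terms in [b] cancel, and the difference of the two sides is a sum of two
     squares. *)
  set U := u t; set V := v t; set F := f t; set G := g t.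
  have -> : F * F + G * G - (2 * U * (a * U - b * V + F) + 2 * V * (b * U + a * V + G)
      - a * (U ^+ 2 + V ^+ 2)) * - a = (F + a * U) ^+ 2 + (G + a * V) ^+ 2 by ring.
  by rewrite addr_ge0 ?sqr_ge0.
have Nle t : 0 <= t -> N t <= N 0.
  have dNle (x : R) : x \in `]0, +oo[ -> derive1 N x <= 0.
    rewrite in_itv /= andbT => x0; have := dN x => dNx.
    by rewrite derive1E derive_val N'0 // ltW.
  move=> t0; apply: (ler0_derive1_nincry _ dNle _ (lexx 0) t0).
    by move=> x _; have [] := dN x.
  by apply: derivable_within_continuous => x _; have [] := dN x.
(* The bound N t <= N 0 is divided by e^(- a t); the constant [|N 0|] is absorbed because e^((- a -
   c') t) >= 1. *)
exists c', (`|N 0| + L); split; rewrite ?addr_ge0 // => t t0.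
rewrite ger0_norm ?addr_ge0 ?sqr_ge0 // -(ler_pM2r (expR_gt0 (- a * t))).
have e1 : expR (- (c' * t)) * expR (- a * t) = expR ((- a - c') * t).
  by rewrite -expRD; congr expR; ring.
rewrite -mulrA e1 [leRHS]mulrDl -lerBlDr (le_trans (Nle _ t0)) // (le_trans (ler_norm _)) //.
by rewrite ler_peMr // -expR0 ler_expR mulr_ge0 //; lra.
Qed.

Lemma Re_mxC_mulmx (R : realType) (p q r : nat) (X : 'M[R]_(p, q)) (Q : 'M[R[i]]_(q, r)) i j :
  complex.Re ((mxC X *m Q) i j) = \sum_l X i l * complex.Re (Q l j).
Proof.
rewrite mxE raddf_sum; apply: eq_bigr => l _ /=.
by rewrite mxE; case: (Q l j) => x y /=; rewrite mul0r subr0.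
Qed.

Lemma Im_mxC_mulmx (R : realType) (p q r : nat) (X : 'M[R]_(p, q)) (Q : 'M[R[i]]_(q, r)) i j :
  complex.Im ((mxC X *m Q) i j) = \sum_l X i l * complex.Im (Q l j).
Proof.
rewrite mxE raddf_sum; apply: eq_bigr => l _ /=.
by rewrite mxE; case: (Q l j) => x y /=; rewrite mul0r addr0.
Qed.

Lemma is_derive_expmx_comb (R : realType) (n : nat) (A : 'M[R]_n) i (w : 'I_n -> R) (t : R) :
  is_derive t 1 (fun t => \sum_l expmx (t *: A) i l * w l)
    (\sum_l (expmx (t *: A) *m A) i l * w l).
Proof.
have -> : (fun t => \sum_l expmx (t *: A) i l * w l) =
    \sum_l (fun t => expmx (t *: A) i l * w l).
  by apply/funext => s; rewrite fct_sumE.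
apply: is_derive_sum => l; have := is_derive_expmx A i l t => dl.
by apply: is_derive_eq; rewrite scaler0 add0r /GRing.scale /=; ring.
Qed.

(* With Q = p(A) and Y = e^(tA) Q, one has Y' = z Y + e^(tA) (A - z) Q, so decay
   propagates through the linear factors of an annihilating polynomial. *)
Lemma expmx_horner_decay (R : realType) (n : nat) (A : 'M[R]_n.+1) (s : seq R[i])
    (p : {poly R[i]}) :
  (forall z, z \in s -> complex.Re z < 0) ->
  horner_mx (mxC A) (p * \prod_(z <- s) ('X - z%:P)) = 0 ->
  forall i j,
    expdecay (fun t => complex.Re ((mxC (expmx (t *: A)) *m horner_mx (mxC A) p) i j)) /\
    expdecay (fun t => complex.Im ((mxC (expmx (t *: A)) *m horner_mx (mxC A) p) i j)).
Proof.
elim: s p => [|z s IH] p s0.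
  rewrite big_nil mulr1 => -> i j; split; under eq_fun do rewrite mulmx0 mxE /=; exact: expdecay0.
(* The first linear factor moves into [p], so the induction hypothesis gives decay of e^(tA) (A - z)
   p(A), the forcing term of the equation for e^(tA) p(A). *)
rewrite big_cons mulrA => /IH H i j.
have {H}[fd gd] := H (fun y ys => s0 y (mem_behead (s := z :: s) ys)) i j.
set Q := horner_mx _ _.
set Q1 := horner_mx _ _ in fd gd.
have AQ : mxC A *m Q = z *: Q + Q1.
  rewrite /Q /Q1 mulrBr rmorphB /= !rmorphM /= horner_mx_X horner_mx_C.
  rewrite -[z *: _]mul_mx_scalar addrC subrK.
  exact/esym/comm_horner_mx.
have ReM (x y : R[i]) :
  complex.Re (x * y) = complex.Re x * complex.Re y - complex.Im x * complex.Im y.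
  by case: x y => ? ? [].
have ImM (x y : R[i]) :
  complex.Im (x * y) = complex.Re x * complex.Im y + complex.Im x * complex.Re y.
  by case: x y => ? ? [].
(* The real and imaginary parts of y' = z y + h form the planar system of [expdecay_ode] with a = Re
   z and b = Im z. *)
apply: (expdecay_ode (s0 z (mem_head _ _)) _ _ fd gd) => t.
- under eq_fun do rewrite Re_mxC_mulmx.
  apply: is_derive_eq; first exact: is_derive_expmx_comb.
  rewrite -Re_mxC_mulmx [mxC (_ *m _)]map_mxM -mulmxA -/(mxC _) -/(mxC _) AQ.
  rewrite mulmxDr -scalemxAr !mxE.
  by rewrite raddfD /= ReM.
- under eq_fun do rewrite Im_mxC_mulmx.
  apply: is_derive_eq; first exact: is_derive_expmx_comb.
  rewrite -Im_mxC_mulmx [mxC (_ *m _)]map_mxM -mulmxA -/(mxC _) -/(mxC _) AQ.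
  rewrite mulmxDr -scalemxAr !mxE.
  by rewrite raddfD /= ImM; congr (_ + _); exact: addrC.
Qed.

Lemma hurwitz_Re (R : realType) (n : nat) (A : 'M[R]_n) (z : R[i]) :
  hurwitz A -> root (char_poly (mxC A)) z -> complex.Re z < 0.
Proof.
move=> hA; rewrite -eigenvalue_root_char => /hA.
by rewrite -complexRe ltcR.
Qed.

(** The case p = 1 of [expmx_horner_decay]: the characteristic polynomial splits over [R[i]],
    annihilates A by Cayley-Hamilton, and has all its roots in the open left half-plane. *)
Lemma expmx_decay (R : realType) (n : nat) (A : 'M[R]_n) i j :
  hurwitz A -> expdecay (fun t => expmx (t *: A) i j).
Proof.
case: n A i j => [A []//|n] A i j hA.
have [s sE] := closed_field_poly_normal (char_poly (mxC A)).
have charE : char_poly (mxC A) = \prod_(z <- s) ('X - z%:P).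
  by rewrite sE (monicP (char_poly_monic _)) scale1r.
have s0 z : z \in s -> complex.Re z < 0.
  by move=> zs; apply: (hurwitz_Re hA); rewrite charE root_prod_XsubC.
have ann : horner_mx (mxC A) (1 * \prod_(z <- s) ('X - z%:P)) = 0.
  by rewrite mul1r -charE; exact: Cayley_Hamilton.
have [+ _] := expmx_horner_decay s0 ann i j.
apply: expdecay_le => t; rewrite rmorph1 mulmx1 mxE.
by [].
Qed.

(** * The Lyapunov integral *)

Lemma is_derive_exp_primitive (R : realType) (c K t : R) : c != 0 ->
  is_derive t 1 (fun t => - (K / c) * expR (- (c * t))) (K * expR (- (c * t))).
Proof.
by move=> c0; apply: is_derive_eq; rewrite /GRing.scale /=; field.
Qed.

Lemma continuous_exp (R : realType) (c K : R) : continuous (fun t => K * expR (- (c * t))).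
Proof.
move=> t; apply: cvgMl_tmp.
apply: (continuous_comp (f := fun t => - (c * t))); last exact: continuous_expR.
by apply: cvgN; apply: cvgMl_tmp; exact: cvg_id.
Qed.

Lemma expdecay_exp (R : realType) (c K : R) : 0 < c -> expdecay (fun t => K * expR (- (c * t))).
Proof.
by move=> c0; exists c, `|K|; split=> // t _; rewrite normrM (ger0_norm (expR_ge0 _)).
Qed.

Lemma ge0_expdecay_FTC2y (R : realType) (f F : R -> R) :
  (forall t, 0 <= t -> 0 <= f t) -> continuous f ->
  (forall t : R, is_derive t 1 F (f t)) -> expdecay F ->
  (\int[lebesgue_measure]_(t in (`[0%R, +oo[%classic : set R)) (f t)%:E = (- F 0)%:E)%E.
Proof.
move=> f0 cf dF Fd.
have derF t : derivable F t 1 by have [] := dF t.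
have cvgF : F t @[t --> 0^'+] --> F 0.
  by apply: cvg_at_right_filter; apply: differentiable_continuous; exact/derivable1_diffP.
have F'f : {in `]0, +oo[, derive1 F =1 f}.
  by move=> t _; have dFt := dF t; rewrite derive1E derive_val.
rewrite (ge0_continuous_FTC2y f0 (continuous_subspaceT cf) (expdecay_cvg0 Fd)
  (fun t _ => derF t) cvgF F'f).
by rewrite -EFinB sub0r.
Qed.

Lemma continuous_itv_measurable (R : realType) (f : R -> R) :
  continuous f -> measurable_fun (`[0%R, +oo[%classic : set R) f.
Proof.
by move=> cf; apply: measurable_funTS; exact: continuous_measurable_fun.
Qed.

Lemma integrable_exp (R : realType) (c K : R) : 0 < c -> 0 <= K ->
  (lebesgue_measure).-integrable (`[0%R, +oo[%classic : set R)
    (EFin \o (fun t => K * expR (- (c * t)))).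
Proof.
move=> c0 K0.
apply/integrableP; split.
  by apply/measurable_EFinP; apply: continuous_itv_measurable; exact: (@continuous_exp R c K).
have ge0 t : 0 <= K * expR (- (c * t)) by rewrite mulr_ge0 ?expR_ge0.
under eq_integral do rewrite /= ger0_norm //.
have dE (t : R) := is_derive_exp_primitive K t (lt0r_neq0 c0).
by rewrite (ge0_expdecay_FTC2y (fun t _ => ge0 t) (@continuous_exp _ c K) dE
  (expdecay_exp _ c0)) ltry.
Qed.

Lemma expdecay_integrable (R : realType) (f : R -> R) :
  continuous f -> expdecay f ->
  (lebesgue_measure).-integrable (`[0%R, +oo[%classic : set R) (EFin \o f).
Proof.
move=> cf [c [K [c0 K0 fK]]].
apply: (le_integrable _ _ _ (integrable_exp c0 K0)) => //.
  by apply/measurable_EFinP; exact: continuous_itv_measurable.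
move=> t /=; rewrite in_itv /= andbT => t0.
by rewrite lee_fin [leRHS]ger0_norm ?fK // mulr_ge0 ?expR_ge0.
Qed.

(* Adding a multiple of e^(-ct) makes f nonnegative, which reduces the claim to
   the nonnegative case. *)
Lemma expdecay_FTC2y (R : realType) (f F : R -> R) :
  continuous f -> (forall t : R, is_derive t 1 F (f t)) ->
  expdecay f -> expdecay F ->
  \int[lebesgue_measure]_(t in `[0, +oo[%classic) f t = - F 0.
Proof.
move=> cf dF fd Fd; have [c [K [c0 K0 fK]]] := fd.
pose e t := K * expR (- (c * t)).
pose E t := - (K / c) * expR (- (c * t)).
have dE (t : R) : is_derive t 1 E (e t) := is_derive_exp_primitive K t (lt0r_neq0 c0).
have Ed : expdecay E by exact: expdecay_exp.
have ce : continuous e by exact: continuous_exp.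
have e0 t : 0 <= e t by rewrite mulr_ge0 ?expR_ge0.
have inte : \int[lebesgue_measure]_(t in `[0, +oo[%classic) e t = - E 0.
  by rewrite /Rintegral (ge0_expdecay_FTC2y (fun t _ => e0 t) ce dE Ed).
have intef : \int[lebesgue_measure]_(t in `[0, +oo[%classic) (f t + e t) = - (F 0 + E 0).
  have fe0 t : 0 <= t -> 0 <= f t + e t.
    by move=> t0; rewrite -lerBlDr sub0r; have := fK _ t0; rewrite ler_norml => /andP[].
  have cfe : continuous (fun t => f t + e t).
    by move=> t; apply: cvgD; [exact: cf|exact: ce].
  have dFE (t : R) : is_derive t 1 (fun t => F t + E t) (f t + e t).
    by have := dF t; have := dE t => dEt dFt; exact: is_deriveD.
  by rewrite /Rintegral (ge0_expdecay_FTC2y fe0 cfe dFE (expdecayD Fd Ed)).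
move: intef; rewrite RintegralD //; first by rewrite inte opprD => /addIr.
  exact: expdecay_integrable.
exact: integrable_exp.
Qed.

Lemma lyap_integrand_continuous (R : realType) (n : nat) (A V : 'M[R]_n) i j :
  continuous (fun t : R => (expmx (t *: A) *m V *m expmx (t *: A^T)) i j).
Proof.
move=> t; apply: differentiable_continuous; apply/derivable1_diffP.
by have [] := is_derive_expmx_sandwich A V i j t.
Qed.

Lemma lyap_integrand_decay (R : realType) (n : nat) (A V : 'M[R]_n) i j : hurwitz A ->
  expdecay (fun t => (expmx (t *: A) *m V *m expmx (t *: A^T)) i j).
Proof.
move=> hA; under eq_fun do rewrite expmx_trmx mxE.
apply: expdecay_sum => l; under eq_fun do rewrite mxE [_^T _ _]mxE.
apply: expdecayM; last exact: expmx_decay.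
by apply: expdecay_sum => h; apply: expdecayZ; exact: expmx_decay.
Qed.

Lemma lyap_integrable (R : realType) (n : nat) (A V : 'M[R]_n) i j : hurwitz A ->
  (lebesgue_measure).-integrable (`[0%R, +oo[%classic : set R)
    (EFin \o (fun t => (expmx (t *: A) *m V *m expmx (t *: A^T)) i j)).
Proof.
move=> hA; apply: expdecay_integrable.
  exact: lyap_integrand_continuous.
exact: lyap_integrand_decay.
Qed.

(** The integrand is the derivative of e^(tA) V e^(tA^T), which equals V at 0 and vanishes at
    infinity. *)
Lemma lyap_derivE (R : realType) (n : nat) (A V : 'M[R]_n) i j : hurwitz A ->
  lyap A (A *m V + V *m A^T) i j = - V i j.
Proof.
move=> hA; rewrite mxE.
rewrite (expdecay_FTC2y (@lyap_integrand_continuous _ _ _ _ _ _)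
  (is_derive_expmx_sandwich A V i j) (lyap_integrand_decay _ _ _ hA)
  (lyap_integrand_decay _ _ _ hA)).
by rewrite !scale0r !expmx0 mul1mx mulmx1.
Qed.

Lemma expmx_comm (R : realType) (n : nat) (A : 'M[R]_n) (t : R) :
  A *m expmx (t *: A) = expmx (t *: A) *m A.
Proof.
pose u := series (fun k => (k`!%:R)^-1 *: (t *: A) ^+ k).
have ue : u @ \oo --> expmx (t *: A).
  have := @expmx_scale_has_sum _ _ A t.
  by rewrite /expmx => tA; rewrite (mx_has_sum_lim tA).
(* Partial sums commute with A; the identity factors fit the two-sided form of [cvg_mulmx]. *)
have commu : (fun N => A *m u N *m 1%:M) = (fun N => 1%:M *m u N *m A).
  apply/funext => N; rewrite mul1mx mulmx1 mulmx_suml mulmx_sumr.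
  apply: eq_bigr => k _; rewrite expr_scalemx -!(scalemxAl, scalemxAr).
  by rewrite !mulmxE -exprS -exprSr.
rewrite -[LHS]mulmx1 -[X in _ = X *m A]mul1mx.
by rewrite -(limnE (cvg_mulmx (P := A) (Q := 1%:M) ue)) commu
  (limnE (cvg_mulmx (P := 1%:M) (Q := A) ue)).
Qed.

(** Integrability and value are proved together, because additivity of the integral at each
    induction step needs the remaining sum to be integrable. *)
Lemma Rintegral_comb (R : realType) (I : finType) (a : I -> R) (f : I -> R -> R) :
  (forall i, (lebesgue_measure).-integrable (`[0%R, +oo[%classic : set R) (EFin \o f i)) ->
  (lebesgue_measure).-integrable (`[0%R, +oo[%classic : set R)
    (EFin \o (fun t => \sum_i a i * f i t)) /\
  \int[lebesgue_measure]_(t in `[0, +oo[%classic) (\sum_i a i * f i t) =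
  \sum_i a i * \int[lebesgue_measure]_(t in `[0, +oo[%classic) f i t.
Proof.
move=> fi; have intZ i : (lebesgue_measure).-integrable (`[0%R, +oo[%classic : set R)
    (EFin \o (fun t => a i * f i t)).
  by apply: (integrableZl _ (a i) (fi i)).
elim: (index_enum I) => [|i s [IHi IH]].
  split.
    rewrite (_ : _ \o _ = cst 0%E); first exact: integrable0.
    by apply/funext => t /=; rewrite big_nil.
  by under eq_Rintegral do rewrite big_nil; rewrite big_nil Rintegral_cst // mul0r.
split.
  rewrite (_ : _ \o _ = (EFin \o (fun t => (a i * f i t)%R)) \+
      (EFin \o (fun t => (\sum_(k <- s) a k * f k t)%R)))%E.
    exact: (integrableD _ (intZ i) IHi).
  by apply/funext => t /=; rewrite big_cons EFinD.
under eq_Rintegral do rewrite big_cons.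
by rewrite RintegralD // IH big_cons RintegralZl.
Qed.

(** A and A^T commute with their exponentials, so by linearity of the integral the first two terms
    add up to [lyap A (A *m V + V *m A^T)], which is - V by [lyap_derivE]. *)
Lemma lyap_eq (R : realType) (n : nat) (A V : 'M[R]_n) : hurwitz A ->
  A *m lyap A V + lyap A V *m A^T + V = 0.
Proof.
move=> hA; apply/matrixP => i j; rewrite [LHS]mxE [RHS]mxE.
apply/eqP; rewrite addr_eq0 -(lyap_derivE V i j hA); apply/eqP.
pose H t := expmx (t *: A) *m V *m expmx (t *: A^T).
have split t : (expmx (t *: A) *m (A *m V + V *m A^T) *m expmx (t *: A^T)) i j =
    \sum_l A i l * H t l j + \sum_l A j l * H t i l.
  have -> : expmx (t *: A) *m (A *m V + V *m A^T) *m expmx (t *: A^T) =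
      A *m H t + H t *m A^T.
    rewrite mulmxDr mulmxDl /H !mulmxA (expmx_comm A t).
    by rewrite -[in RHS](mulmxA _ (expmx _) A^T) -(expmx_comm A^T t) !mulmxA.
  rewrite [LHS]mxE [(A *m H t) i j]mxE [(H t *m A^T) i j]mxE; congr (_ + _).
  by apply: eq_bigr => l _; rewrite [A^T l j]mxE mulrC.
rewrite [RHS]mxE; under [RHS]eq_Rintegral do rewrite split.
have comb (a : 'I_n -> R) (h k : 'I_n -> 'I_n) :=
  Rintegral_comb a (fun l => lyap_integrable V (h l) (k l) hA).
have [int1 E1] := comb (A i) id (fun=> j).
have [int2 E2] := comb (A j) (fun=> i) id.
rewrite RintegralD // [X in _ = X + _]E1 [X in _ = _ + X]E2.
rewrite [LHS]mxE [(A *m _) i j]mxE [(_ *m A^T) i j]mxE.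
congr (_ + _); apply: eq_bigr => l _; first by rewrite [lyap A V l j]mxE.
by rewrite [lyap A V i l]mxE [A^T l j]mxE mulrC.
Qed.

Lemma trmx_lyap (R : realType) (n : nat) (A V : 'M[R]_n) :
  (lyap A V)^T = lyap A V^T.
Proof.
apply/matrixP => i j; rewrite !mxE; apply: eq_Rintegral => t _.
have -> : expmx (t *: A) *m V^T *m expmx (t *: A^T) =
    (expmx (t *: A) *m V *m expmx (t *: A^T))^T.
  by rewrite !trmx_mul expmx_trmx trmxK mulmxA.
by rewrite [RHS]mxE.
Qed.

Lemma lyapN (R : realType) (n : nat) (A V : 'M[R]_n) : hurwitz A ->
  lyap A (- V) = - lyap A V.
Proof.
move=> hA; apply/matrixP => i j; rewrite !mxE.
rewrite -[RHS]mulN1r -RintegralZl //; last exact: lyap_integrable.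
by apply: eq_Rintegral => t _; rewrite mulmxN mulNmx mxE mulN1r.
Qed.

(** * The factorisation *)

Lemma mul_expr_shift (K : pzRingType) (x y : K) k :
  (x * y) ^+ k * x = x * (y * x) ^+ k.
Proof.
elim: k => [|k IH]; first by rewrite !expr0 mulr1 mul1r.
by rewrite exprS -mulrA IH exprS !mulrA.
Qed.

(** With y = e' b' e g, the hypothesis makes the repeated factor (b g) y. Shifting the bracketing by
    b g turns it into y (b g) = e' b' e (g b g), where the next source g b g appears; a second shift
    by e' restores the original shape. *)
Lemma sandwich_expr_step (K : pzRingType) (e e' b g b' w : K) k :
  e * w * e' = g * e' * b' * e * g ->
  e' * (b * (e * w * e')) ^+ k.+1 * b * e =
    e' * b * g * (e' * (b' * (e * (g * b * g) * e')) ^+ k * b' * e) * g * b * e.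
Proof.
move=> ->; pose y := e' * b' * e * g.
have -> : b * (g * e' * b' * e * g) = (b * g) * y by rewrite !mulrA.
rewrite exprSr [_ ^+ k * _]mulrA mul_expr_shift.
have -> : y * (b * g) = e' * (b' * e * (g * b * g)) by rewrite /y !mulrA.
have shift := mul_expr_shift e' (b' * e * (g * b * g)) k.
have -> : b' * (e * (g * b * g) * e') = b' * e * (g * b * g) * e' by rewrite !mulrA.
by rewrite -shift /y !mulrA.
Qed.

(** Both sides reduce to g D'^-1 + D^-1 g. It is meant for D = s - A and D' its adjoint. *)
Lemma lyap_swap (K : comUnitRingType) (n : nat) (D D' g W : 'M[K]_n) :
  D \in unitmx -> D' \in unitmx -> g \in unitmx -> D *m g + g *m D' = W ->
  invmx D *m W *m invmx D' =
    g *m invmx D' *m (invmx g *m W *m invmx g) *m invmx D *m g.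
Proof.
move=> uD uD' ug <-.
have -> : invmx D *m (D *m g + g *m D') *m invmx D' = g *m invmx D' + invmx D *m g.
  by rewrite mulmxDr mulmxDl !mulmxA mulVmx // mul1mx mulmxK.
rewrite !(mulmxDr, mulmxDl) !mulmxA; congr (_ + _).
  by rewrite (mulmxK ug) (mulmxK uD) (mulmxKV ug).
by rewrite (mulmxKV ug) (mulmxKV uD') (mulmxV ug) mul1mx.
Qed.

Lemma signed_scale_lyap (R : realType) (n : nat) (A V : 'M[R]_n) k : hurwitz A ->
  lyap A ((-1) ^+ k *: V) = (-1) ^+ k *: lyap A V.
Proof.
move=> hA; rewrite -signr_odd; case: (odd k); rewrite ?expr1 ?expr0 ?scale1r //.
by rewrite !scaleN1r lyapN.
Qed.

Lemma invmx_sign (K : comUnitRingType) (n : nat) (X : 'M[K]_n) k : X \in unitmx ->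
  invmx ((-1) ^+ k *: X) = (-1) ^+ k *: invmx X.
Proof.
move=> uX; rewrite invmxZ ?unitmxZ ?unitrX ?unitrN1 //.
by rewrite -exprVn invrN1.
Qed.

(** The inhomogeneous term of the Lyapunov equation solved by [gamma j]. For j >= 1 it is alpha_j
    gamma_(j-1); the value [mho] at 0 lets index 0 follow the general pattern. *)
Definition lyap_source (R : realType) (n : nat) (A Theta mho : 'M[R]_n) (j : nat) :=
  if j is i.+1 then
    gamma A Theta mho i *m beta A Theta mho i *m gamma A Theta mho i
  else mho.

Lemma alphaSE (R : realType) (n : nat) (A Theta mho : 'M[R]_n) j :
  alpha A Theta mho j.+1 = gamma A Theta mho j *m beta A Theta mho j.
Proof.
case: j => [|j]; first by rewrite mulmx1.
by have [] := abg_rec A Theta mho (ltn0Sn j).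
Qed.

Lemma betaSE (R : realType) (n : nat) (A Theta mho : 'M[R]_n) j :
  beta A Theta mho j.+1 = invmx (gamma A Theta mho j) *m
    lyap_source A Theta mho j *m invmx (gamma A Theta mho j).
Proof.
case: j => [//|j]; have [_ -> _] := abg_rec A Theta mho (ltn0Sn j).
by rewrite alphaSE /= !mulmxA.
Qed.

Lemma gammaSE (R : realType) (n : nat) (A Theta mho : 'M[R]_n) j :
  gamma A Theta mho j.+1 = lyap A (lyap_source A Theta mho j.+1).
Proof.
by have [_ _ ->] := abg_rec A Theta mho (ltn0Sn j); rewrite alphaSE.
Qed.

Lemma gamma_lyap (R : realType) (n : nat) (A Theta mho : 'M[R]_n) j :
  hurwitz A -> A *m Theta + Theta *m A^T + mho = 0 ->
  A *m gamma A Theta mho j + gamma A Theta mho j *m A^T + lyap_source A Theta mho j = 0.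
Proof. by move=> hA base; case: j => [//|j]; rewrite gammaSE lyap_eq. Qed.

(** Transposition commutes with [lyap A], so gamma_(j+1) inherits the sign of its source. The
    exponents of g b g add up to 3j + 2, of the parity of j + 2; those of beta_(j+1) add up to 3(j +
    1), of the parity of j + 1. *)
Lemma abg_parity (R : realType) (n : nat) (A Theta mho : 'M[R]_n) :
  hurwitz A -> Theta^T = - Theta -> mho^T = - mho ->
  (forall j, gamma A Theta mho j \in unitmx) ->
  forall j, [/\ (gamma A Theta mho j)^T = (-1) ^+ j.+1 *: gamma A Theta mho j,
    (beta A Theta mho j)^T = (-1) ^+ j *: beta A Theta mho j &
    (lyap_source A Theta mho j)^T = (-1) ^+ j.+1 *: lyap_source A Theta mho j].
Proof.
move=> hA ThetaT mhoT gU; elim=> [|j [IHg IHb IHw]].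
  by rewrite expr1 !scaleN1r expr0 scale1r trmx1.
have WT : (lyap_source A Theta mho j.+1)^T =
    (-1) ^+ j.+2 *: lyap_source A Theta mho j.+1.
  rewrite /= !trmx_mul IHg IHb -!(scalemxAl, scalemxAr) !scalerA mulmxA.
  by congr (_ *: _); rewrite -!exprD -[LHS]signr_odd -[RHS]signr_odd !(oddD, oddS); case: (odd j).
split=> //; first by rewrite gammaSE trmx_lyap WT signed_scale_lyap.
rewrite betaSE !trmx_mul trmx_inv IHg IHw invmx_sign //.
rewrite -!(scalemxAl, scalemxAr) !scalerA mulmxA.
by congr (_ *: _); rewrite -!exprD -[LHS]signr_odd -[RHS]signr_odd !(oddD, oddS); case: (odd j).
Qed.

Lemma trmxC_mxC (R : realType) (n : nat) (X : 'M[R]_n) : (mxC X)^t* = mxC X^T.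
Proof. by apply/matrixP => i j; rewrite !mxE; exact: conjc_real. Qed.

Lemma trmxCM (R : realType) (n : nat) (X Y : 'M[R[i]]_n) :
  (X *m Y)^t* = Y^t* *m X^t*.
Proof. by rewrite trmx_mul map_mxM. Qed.

Lemma resolvent_den_unit (R : realType) (n : nat) (A : 'M[R]_n) (lambda : R) :
  hurwitz A -> ('i * lambda%:C)%:M - mxC A \in unitmx.
Proof.
move=> hA; rewrite -opprB -scaleN1r unitmxZ ?unitrN1 //.
(* A nonzero kernel of A - s makes s an eigenvalue, yet s = i lambda has real part 0. *)
apply: contraT; rewrite -row_free_unit -kermx_eq0 => /(hA _).
by rewrite -complexRe ltcR /= !(mul0r, mul1r, mulr0) subrr ltxx.
Qed.

Lemma resolvent_den_adj (R : realType) (n : nat) (A : 'M[R]_n) (lambda : R) :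
  (('i * lambda%:C)%:M - mxC A)^t* = (- ('i * lambda%:C))%:M - mxC A^T.
Proof.
rewrite linearB /= tr_scalar_mx map_mxB map_scalar_mx trmxC_mxC /=.
congr (_%:M - _); rewrite rmorphM /= conjCi.
by rewrite (conjc_real lambda : (lambda%:C)^*%R = _) mulNr.
Qed.

Lemma Jmx_tr (K : pzRingType) (m : nat) : (Jmx K m)^T = - Jmx K m.
Proof. by apply/matrixP => i j; rewrite !mxE opprB. Qed.

(** The terms Theta R Theta cancel, and Theta M^T J M Theta occurs with coefficients 2, 2 and -4. *)
Lemma realizability_lyap (R : realType) (n m : nat) (Theta Rmx : 'M[R]_n)
    (J : 'M[R]_m) (M : 'M[R]_(m, n)) :
  Theta^T = - Theta -> Rmx^T = Rmx -> J^T = - J ->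
  let A := 2 *: (Theta *m (Rmx + M^T *m J *m M)) in
  let B := 2 *: (Theta *m M^T) in
  A *m Theta + Theta *m A^T + B *m J *m B^T = 0.
Proof.
move=> ThetaT RT JT /=.
rewrite !linearZ /= !trmx_mul !linearD /= !trmx_mul !trmxK ThetaT RT JT.
rewrite !(mulmxDl, mulmxDr, scalerDr, mulmxN, mulNmx) -!(scalemxAl, scalemxAr) !mulmxA.
move: (Theta *m Rmx *m Theta) (Theta *m _ *m J *m M *m Theta) => X Y.
by apply/matrixP => i j; rewrite !mxE; ring.
Qed.

Lemma blkdiag_mul_col (R : realType) (n : nat) (D G : nat -> 'M[R[i]]_n) k :
  blkmx_mul_col (blkdiag D) G k = D k *m G k.
Proof.
(* From N = k + 1 on, a partial sum contains the only diagonal term and is constant. *)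
apply: limnE; apply: cvg_near_cst; exists k.+1 => // N /= kN.
rewrite /series /= big_mkord (bigD1 (Ordinal kN)) //= /blkdiag eqxx big1 ?addr0 // => l.
by rewrite -val_eqE /= eq_sym => /negbTE ->; rewrite mul0mx.
Qed.

Lemma Sigma_has_sum (R : realType) (n : nat) (A mho : 'M[R]_n) (theta lambda : R) :
  let E := resolvent A ('i * lambda%:C) in
  mx_has_sum (fun k => (2 * 'i * theta%:C) ^+ k * phi_coef R[i] k *:
    (E^t* *m Psi A mho lambda ^+ k *m E)) (Sigma A mho theta lambda).
Proof.
move=> E; have := cvg_mulmx (P := E^t*) (Q := E)
  (@phi_mx_has_sum _ _ ((2 * 'i * theta%:C) *: Psi A mho lambda)).
set v := (fun k => _ *: (E^t* *m _ *m E)); rewrite /mx_has_sum.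
suff -> : series v = fun N => E^t* *m series
    (fun k => phi_coef R[i] k *: ((2 * 'i * theta%:C) *: Psi A mho lambda) ^+ k) N *m E by [].
apply/funext => N; rewrite mulmx_sumr mulmx_suml; apply: eq_bigr => k _.
by rewrite expr_scalemx scalerA mulrC -scalemxAr -scalemxAl.
Qed.

Lemma GHG_has_sum (R : realType) (n : nat) (A Theta mho : 'M[R]_n) (theta lambda : R)
    (Y : 'M[R[i]]_n) :
  let G := Gblk A Theta mho ('i * lambda%:C) in
  mx_has_sum (fun k => Hcoef theta k *:
      ((G k)^t* *m mxC (beta A Theta mho k) *m G k)) Y ->
  GHG A Theta mho theta lambda = Y.
Proof.
move=> G /mx_has_sum_lim <-; rewrite /GHG /blkrow_mul_col; congr mx_series.
apply/funext => k; rewrite /Hblk blkdiag_mul_col /blkcol_adj.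
by rewrite -scalemxAl -scalemxAr mulmxA.
Qed.

Lemma Hcoef_sign (R : realType) (theta : R) k :
  Hcoef theta k = (2 * 'i * theta%:C) ^+ k * phi_coef R[i] k * (-1) ^+ k.
Proof.
have signE (K : comPzRingType) (x y : K) : (- x) ^+ k * y = x ^+ k * y * (-1) ^+ k.
  by rewrite [(- x) ^+ k]exprNn [RHS]mulrC mulrA.
exact: signE.
Qed.

Section Factorisation.
Variables (R : realType) (n : nat) (A Theta mho : 'M[R]_n) (lambda : R).
Hypotheses (hA : hurwitz A) (base : A *m Theta + Theta *m A^T + mho = 0).
Hypotheses (ThetaT : Theta^T = - Theta) (mhoT : mho^T = - mho).
Hypothesis gU : forall j, gamma A Theta mho j \in unitmx.

Let s : R[i] := 'i * lambda%:C.
Let E := resolvent A s.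
Let g j := mxC (gamma A Theta mho j).
Let b j := mxC (beta A Theta mho j).
Let W j := mxC (lyap_source A Theta mho j).
(** The sandwiched k-th power at level j of the recursion. At level 0 it is E^* Psi^k E, because
    [b 0] is the identity and [W 0] is [mho]. *)
Let F j k := E^t* *m (b j *m (E *m W j *m E^t*)) ^+ k *m b j *m E.

Let swap j : E *m W j *m E^t* = g j *m E^t* *m b j.+1 *m E *m g j.
Proof.
rewrite /E /resolvent trmx_inv map_invmx resolvent_den_adj.
rewrite (@lyap_swap _ _ _ _ (g j)).
- by rewrite /b betaSE /mxC !map_mxM map_invmx.
- exact: resolvent_den_unit.
- by rewrite -resolvent_den_adj map_unitmx unitmx_tr resolvent_den_unit.
- by rewrite /g /mxC map_unitmx.
have /(congr1 (@mxC R n n)) := gamma_lyap j hA base.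
rewrite /mxC !map_mxD !map_mxM map_mx0 => /eqP; rewrite addr_eq0 => /eqP e.
(* As s is imaginary, the adjoint of s - A is - s - A^T, and the two scalar contributions cancel. *)
rewrite /W /mxC -[RHS]opprK -e mulmxBl mulmxBr mul_scalar_mx mul_mx_scalar scaleNr.
by rewrite opprD addrACA subrr add0r.
Qed.

Let F_step j k : F j k.+1 = E^t* *m b j *m g j *m F j.+1 k *m g j *m b j *m E.
Proof.
have := sandwich_expr_step (b j) k (swap j).
by rewrite /F /W /= /mxC !map_mxM.
Qed.

(** G_k without its leftmost resolvent: the outer factor accumulated after k unrolling steps. *)
Let Q k : 'M[R[i]]_n := if k is k'.+1 then g k' *m b k' *m Gblk A Theta mho s k' else 1%:M.

Let GblkE k : Gblk A Theta mho s k = E *m Q k.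
Proof.
case: k => [|k]; first by rewrite mulmx1.
by rewrite /Q /= alphaSE /mxC map_mxM !mulmxA.
Qed.

Let QSE k : Q k.+1 = g k *m b k *m E *m Q k.
Proof. by rewrite /= GblkE mulmxA. Qed.

(** At equal index gamma and beta have opposite parities, hence the minus sign. *)
Let QS_adj k : (Q k.+1)^t* = - ((Q k)^t* *m E^t* *m b k *m g k).
Proof.
have [gT bT _] := abg_parity hA ThetaT mhoT gU k.
rewrite QSE !trmxCM !trmxC_mxC gT bT /mxC !map_mxZ.
rewrite !rmorphXn /= rmorphN1 -!(scalemxAl, scalemxAr) scalerA.
have -> : (-1) ^+ k * (-1) ^+ k.+1 = -1 :> R[i].
  by rewrite exprS mulrCA -exprMn mulrNN mulr1 expr1n mulr1.
by rewrite scaleN1r !mulmxA.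
Qed.

(** Each use of [F_step] trades one power for one level. Its outer factors extend [Q j] on the right
    and, up to the sign from [QS_adj], its adjoint on the left. *)
Let F_unroll k j :
  F 0 (j + k) = (-1) ^+ j *: ((Q j)^t* *m F j k *m Q j).
Proof.
elim: j k => [|j IH] k.
  by rewrite expr0 scale1r trmx1 map_mx1 mul1mx mulmx1.
rewrite addSnnS IH F_step QS_adj exprS mulN1r scaleNr !mulNmx scalerN opprK.
congr (_ *: _); rewrite QSE; move: (F j.+1 k) (Q j) => X Y.
by rewrite !mulmxA.
Qed.

Lemma sandwich_PsiX k :
  E^t* *m Psi A mho lambda ^+ k *m E =
    (-1) ^+ k *: ((Gblk A Theta mho s k)^t* *m b k *m Gblk A Theta mho s k).
Proof.
have -> : E^t* *m Psi A mho lambda ^+ k *m E = F 0 k.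
  by rewrite /F /b /W /= /mxC map_mx1 mul1mx mulmx1.
(* After k unrolling steps no power is left: [F k 0] is E^* beta_k E, and E Q_k = G_k. *)
by rewrite -[in LHS](addn0 k) F_unroll GblkE trmxCM /F expr0 mulmx1 !mulmxA.
Qed.

(** The sign from [sandwich_PsiX] cancels the one in (-2 i theta)^k, so the terms are those of
    [Sigma_has_sum]. *)
Lemma GHG_terms_has_sum theta :
  mx_has_sum (fun k => Hcoef theta k *:
      ((Gblk A Theta mho s k)^t* *m mxC (beta A Theta mho k) *m Gblk A Theta mho s k))
    (Sigma A mho theta lambda).
Proof.
have termE k : Hcoef theta k *:
      ((Gblk A Theta mho s k)^t* *m b k *m Gblk A Theta mho s k) =
    ((2 * 'i * theta%:C) ^+ k * phi_coef R[i] k) *: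
      (E^t* *m Psi A mho lambda ^+ k *m E).
  rewrite Hcoef_sign [X in _ = _ *: X]sandwich_PsiX.
  exact/esym/scalerA.
under eq_fun do rewrite termE.
exact: Sigma_has_sum.
Qed.

End Factorisation.

Theorem theorem2 (R : realType) (n m : nat)
    (n_gt0 : (0 < n)%N) (n_even : ~~ odd n)
    (m_gt0 : (0 < m)%N) (m_even : ~~ odd m)
    (Theta Rmx : 'M[R]_n) (M : 'M[R]_(m, n))
    (Theta_nonsing : Theta \in unitmx) (Theta_antisym : Theta^T = - Theta)
    (Rmx_sym : Rmx^T = Rmx) :
  let J : 'M[R]_m := Jmx R m in
  let A : 'M[R]_n := 2 *: (Theta *m (Rmx + M^T *m J *m M)) in
  let B : 'M[R]_(n, m) := 2 *: (Theta *m M^T) in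
  let mho : 'M[R]_n := B *m J *m B^T in
  forall (A_hurwitz : hurwitz A)
    (S : 'M[R[i]]_n)
    (S_sqrt : is_psd_sqrt (mxC B *m (Omega R m)^T *m (mxC B)^T) S)
    (gamma_nonsing : forall j : nat, (1 <= j)%N ->
       \det (gamma A Theta mho j) != 0)
    (theta : R) (theta_ge0 : 0 <= theta)
    (lambda : R),
  let G : nat -> 'M[R[i]]_n := Gblk A Theta mho ('i * lambda%:C) in
  let GHGl : 'M[R[i]]_n := GHG A Theta mho theta lambda in
  mx_has_sum (fun k => Hcoef theta k *:
      ((G k)^t* *m mxC (beta A Theta mho k) *m G k)) GHGl /\
  Delta A mho S theta lambda = S *m GHGl *m S.
Proof.
move=> J A B mho A_hurwitz S S_sqrt gamma_nonsing theta theta_ge0 lambda G GHGl.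
have JT : J^T = - J by exact: Jmx_tr.
have base := realizability_lyap M Theta_antisym Rmx_sym JT.
have mhoT : mho^T = - mho by rewrite /mho !trmx_mul trmxK JT mulNmx mulmxN mulmxA.
have gU j : gamma A Theta mho j \in unitmx.
  (* At index 0 gamma is [Theta], invertible by assumption. *)
  by case: j => [//|j]; rewrite unitmxE unitfE gamma_nonsing.
have sum := @GHG_terms_has_sum _ _ _ _ _ lambda A_hurwitz base Theta_antisym mhoT gU theta.
have GHGE : GHGl = Sigma A mho theta lambda by exact: GHG_has_sum.
by rewrite GHGE; split.
Qed.
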